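(* Let $I_R(x)=\int_0^\infty e^{-xt}\,\dfrac{dt}{t(\pi^2+\log^2 t)}$ for $x>0$, and let $I_R^{(n)}$ denote its $n$-th derivative on $(0,\infty)$ (with $I_R^{(0)}=I_R$). For any non-negative integer $n$, the following hold. (i) For all $x,y>0$ and $\alpha\in(0,1)$, $$(-1)^n I_R^{(n)}\left(\alpha x+(1-\alpha)y\right)\le \left((-1)^n I_R^{(n)}(x)\right)^{\alpha}\left((-1)^n I_R^{(n)}(y)\right)^{1-\alpha}.$$ (ii) (The case $\alpha=\tfrac12$, $y=x+2$.) For all $x>0$, $$\left(I_R^{(n)}(x+1)\right)^2\le I_R^{(n)}(x)\,I_R^{(n)}(x+2).$$
   Context: $I_R$ is the Ramanujan integral, and $\log^2 t$ means $(\log t)^2$ with the natural logarithm. *)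

(* Defs.v *)
From mathcomp Require Import all_boot all_order all_algebra.
From mathcomp Require Import all_classical all_reals all_analysis.

Set Implicit Arguments.
Unset Strict Implicit.
Unset Printing Implicit Defensive.

Import Order.TTheory GRing.Theory Num.Theory.
Import numFieldNormedType.Exports.

Local Open Scope classical_set_scope.
Local Open Scope ring_scope.

(* The mathematical function lives on ]0, +oo[. For x < 0 the integral is +oo
   and the value here is the default 0; since ]0, +oo[ is open, this affects
   neither the values nor the iterated derivatives at points x > 0. *)
Definition ramanujan_integral (R : realType) (x : R) : R :=
  \int[lebesgue_measure]_(t in `]0, +oo[)
    (expR (- (x * t)) / (t * (pi ^+ 2 + ln t ^+ 2))).

(* Main.v *)
Require Import Defs.
From mathcomp Require Import all_boot all_order all_algebra.
From mathcomp Require Import all_classical all_reals all_analysis.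
From mathcomp Require Import measurable_realfun ring lra.

Set Implicit Arguments.
Unset Strict Implicit.
Unset Printing Implicit Defensive.

Import Order.TTheory GRing.Theory Num.Theory.
Import numFieldNormedType.Exports.

Local Open Scope ring_scope.
Local Open Scope classical_set_scope.

(** With [w t = 1 / (t * (pi ^ 2 + ln t ^ 2))], the function at hand is the
Laplace transform of [w], and the theorem is a property of the Laplace transform
of any non-negative integrable weight.

The function [t ^ n * exp (- c * t)] is bounded on the positive half-line for
every [c > 0], by [n! / c ^ n].  Multiplied by the integrable weight [w], it
gives integrands that are integrable, and that are dominated by one integrable
function as [c] ranges over a small neighbourhood of a positive point.
Differentiation under the integral sign therefore applies at every order
([derive1n_laplace_moment]): the [n]-th derivative of the Laplace transform at
[x > 0] is [(-1) ^ n] times the moment [\int t ^ n * exp (- x * t) * w t dt].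

The integrand of that moment at [a * x + (1 - a) * y] is the product of the
[a]-th power of the integrand at [x] and the [(1 - a)]-th power of the integrand
at [y], so Hoelder's inequality with exponents [1 / a] and [1 / (1 - a)] shows
that the moment is logarithmically convex in [x] ([laplace_moment_log_convex]).
The inequality between the values at [x], [x + 1] and [x + 2] is the midpoint
case, squared; the signs cancel.

It remains to see that [w] is integrable near [0] and near infinity
([integrable_ramanujan_weight]).  It has the primitive
[atan (ln t / pi) / pi], whose increments are at most [1]; hence the integrals
of [w] over an increasing sequence of compact intervals exhausting the half-line
are bounded by [1], and so is their limit. *)

(** * Hoelder's inequality for weighted geometric means *)

(** Hoelder's inequality for the real-valued integral, with the exponents
[a^-1] and [(1 - a)^-1] absorbed into the functions. *)
Lemma Rintegral_powR_le d (T : measurableType d) (R : realType)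
    (mu : {measure set T -> \bar R}) (D : set T) (u v : T -> R) (a : R) :
  measurable D -> 0 < a < 1 ->
  (forall t, D t -> 0 <= u t) -> (forall t, D t -> 0 <= v t) ->
  mu.-integrable D (EFin \o u) -> mu.-integrable D (EFin \o v) ->
  \int[mu]_(t in D) (u t `^ a * v t `^ (1 - a)) <=
  (\int[mu]_(t in D) u t) `^ a * (\int[mu]_(t in D) v t) `^ (1 - a).
Proof.
move=> mD /andP[a0 a1] u0 v0 iu iv.
have b0 : 0 < 1 - a by rewrite subr_gt0.
(* Hoelder's inequality is applied on the whole space: [u] and [v] are extended
   by 0 outside [D], and so are their positive powers. *)
have mpow (h : T -> R) c : mu.-integrable D (EFin \o h) ->
    measurable_fun setT (fun t => (h \_ D) t `^ c).
  move=> /integrableP[/measurable_EFinP mh _].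
  apply: (@measurableT_comp _ _ _ _ _ _ (@powR R ^~ c)) => //.
  exact/(measurable_restrictT _ _).1.
have restr_ge0 (h : T -> R) : (forall t, D t -> 0 <= h t) ->
    forall t, 0 <= (h \_ D) t.
  by move=> h0 t; rewrite patchE; case: ifPn => // /set_mem /h0.
have NE (h : T -> R) c : 0 < c -> mu.-integrable D (EFin \o h) ->
    (forall t, D t -> 0 <= h t) ->
    Lnorm mu (c^-1)%:E (EFin \o (fun t => (h \_ D) t `^ c)) =
    ((\int[mu]_(t in D) h t) `^ c)%:E.
  move=> c0 ih h0; rewrite unlock invrK.
  rewrite -poweR_EFin /Rintegral fineK; last exact: integrable_fin_num.
  congr (_ `^ _)%E; rewrite [RHS]integral_mkcond; apply: eq_integral => t _ /=.
  rewrite (ger0_norm (powR_ge0 _ _)) -powRrM mulfV ?gt_eqF// powRr1 ?restr_ge0//.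
  by rewrite restrict_EFin.
have := @hoelder _ _ _ mu _ _ a^-1 (1 - a)^-1 (mpow u a iu) (mpow v (1 - a) iv).
rewrite !invr_gt0 !invrK subrKC => /(_ a0 b0 erefl).
rewrite !NE// Lnorm1 -EFinM.
have -> : (\int[mu]_t `|(EFin \o ((fun t => (u \_ D) t `^ a) \*
      (fun t => (v \_ D) t `^ (1 - a)))%R) t| =
    \int[mu]_(t in D) (u t `^ a * v t `^ (1 - a))%:E)%E.
  rewrite [RHS]integral_mkcond; apply: eq_integral => t _ /=.
  rewrite ger0_norm ?mulr_ge0 ?powR_ge0//.
  by rewrite !patchE; case: ifPn => // _; rewrite powR0 ?gt_eqF// mul0r.
move=> le_uv; rewrite -lee_fin [leLHS]fineK// ge0_fin_numE.
  exact: le_lt_trans le_uv (ltry _).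
by apply: integral_ge0 => t _; rewrite lee_fin mulr_ge0 ?powR_ge0.
Qed.

(** * Moments of a Laplace transform *)

(** The inequality [(c * t) ^ n / n! <= exp (c * t)]: the exponential series
dominates each of its terms. *)
Lemma exprn_expRN_le (R : realType) (n : nat) (c t : R) : 0 < c -> 0 <= t ->
  t ^+ n * expR (- (c * t)) <= n`!%:R / c ^+ n.
Proof.
move=> c0 t0.
rewrite expRN ler_pdivrMr ?expR_gt0// mulrAC ler_pdivlMr ?exprn_gt0//.
have ct0 : 0 <= c * t by rewrite mulr_ge0// ltW.
rewrite -exprMn [t * c]mulrC.
case: n => [|n]; first by rewrite expr0 fact0 mul1r -expR0 ler_expR.
rewrite -ler_pdivrMl ?ltr0n ?fact_gt0// [leLHS]mulrC.
by apply: le_trans (expR_ge1Dxn n ct0); rewrite lerDr.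
Qed.

(** The integral of [t ^ n * exp (- x * t) * w t] over the positive half-line.
For [n = 0] this is the Laplace transform of [w] at [x].  The integral takes the
default value 0 when the extended integral is infinite, which does not happen
for [x > 0] and integrable [w]. *)
Definition laplace_moment {R : realType} (w : R -> R) (n : nat) (x : R) : R :=
  \int[lebesgue_measure]_(t in `]0, +oo[) (t ^+ n * expR (- (x * t)) * w t).

Section laplace.
Context (R : realType) (w : R -> R).
Local Notation mu := (@lebesgue_measure R).
Local Notation D := (`]0, +oo[%classic : set R).
Hypothesis w_ge0 : forall t, D t -> 0 <= w t.
Hypothesis intw : mu.-integrable D (EFin \o w).

Lemma laplace_moment_integrand_integrable (n : nat) (x : R) : 0 < x ->
  mu.-integrable D (EFin \o (fun t => t ^+ n * expR (- (x * t)) * w t)).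
Proof.
move=> x0.
have mD : measurable (D : set (measurableTypeR R)) by exact: measurable_itv.
have /integrableP[/measurable_EFinP mw _] := intw.
have iMw : mu.-integrable D (EFin \o (fun t => n`!%:R / x ^+ n * w t)).
  exact: (integrableZl mD (n`!%:R / x ^+ n) intw
    : mu.-integrable D (fun t => _ * _)%E).
apply: (@le_integrable _ _ _ mu D mD _ _ _ _ iMw).
  apply/measurable_EFinP; apply: measurable_funM => //.
  apply: measurable_funM; first exact: measurable_funX.
  apply: measurableT_comp => //.
  apply: measurableT_comp => //.
move=> t Dt /=; rewrite lee_fin.
have t0 : 0 <= t by move: Dt; rewrite /= in_itv/= andbT => /ltW.
rewrite !normrM -normrM ler_wpM2r// !ger0_norm ?mulr_ge0 ?exprn_ge0 ?expR_ge0//.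
- exact: exprn_expRN_le.
- by rewrite invr_ge0 exprn_ge0// ltW.
Qed.

Lemma laplace_moment_ge0 (n : nat) (x : R) : 0 <= laplace_moment w n x.
Proof.
apply: Rintegral_ge0 => //= t Dt.
have t0 : 0 <= t by move: Dt; rewrite in_itv/= andbT => /ltW.
by rewrite !mulr_ge0 ?exprn_ge0 ?expR_ge0// w_ge0.
Qed.

(** Differentiation under the integral sign. *)
Lemma is_derive_laplace_moment (n : nat) (x : R) : 0 < x ->
  is_derive x 1 (laplace_moment w n) (- laplace_moment w n.+1 x).
Proof.
move=> x0.
pose f (x t : R) := t ^+ n * expR (- (x * t)) * w t.
have df (y t : R) :
    is_derive y 1 (f ^~ t) (- (t ^+ n.+1 * expR (- (y * t)) * w t)).
  rewrite /f; apply: is_derive_eq.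
  rewrite /GRing.scale/= exprS; ring.
have d1f (y t : R) : partial1of2 f y t = - (t ^+ n.+1 * expR (- (y * t)) * w t).
  by rewrite partial1of2E; exact: (@derive_val _ _ _ _ _ _ _ (df y t)).
have mD : measurable (D : set (measurableTypeR R)) by exact: measurable_itv.
(* On the neighbourhood ]x / 2, x + 1[ of [x], the factor
   [t ^ n.+1 * exp (- y * t)] of the derivative is largest at the left end, where
   it is at most [C]. *)
have x2 : 0 < x / 2 by rewrite divr_gt0.
have Ix : `]x / 2, x + 1[%classic x.
  by rewrite /= in_itv/=; apply/andP; split; lra.
have If (y : R) : `]x / 2, x + 1[%classic y -> mu.-integrable D (EFin \o f y).
  rewrite /= in_itv/= => /andP[xy _].
  by apply: laplace_moment_integrand_integrable; lra.
have Df (y t : R) : `]x / 2, x + 1[%classic y -> D t -> derivable (f ^~ t) y 1.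
  by move=> _ _; apply: ex_derive; exact: df.
pose C := n.+1`!%:R / (x / 2) ^+ n.+1.
have C0 : 0 <= C by rewrite divr_ge0// exprn_ge0// ltW.
have intG : mu.-integrable D (EFin \o (fun t => `|C * w t|)).
  have iCw : mu.-integrable D (EFin \o (fun t => C * w t)).
    exact: (integrableZl mD C intw : mu.-integrable D (fun t => _ * _)%E).
  exact: integrable_norm iCw.
have G_ub (y t : R) : `]x / 2, x + 1[%classic y -> D t ->
    `|partial1of2 f y t| <= `|C * w t|.
  rewrite /= !in_itv/= andbT => /andP[xy _] t0.
  rewrite d1f normrN normrM [leRHS]normrM ler_wpM2r//.
  rewrite (ger0_norm C0) ger0_norm ?mulr_ge0 ?exprn_ge0 ?expR_ge0 ?(ltW t0)//.
  apply: (le_trans _ (exprn_expRN_le n.+1 x2 (ltW t0))).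
  rewrite ler_wpM2l ?exprn_ge0 ?(ltW t0)// ler_expR lerN2 ler_wpM2r ?(ltW t0)//.
  exact: ltW.
have G0 (t : R) : 0 <= `|C * w t| by [].
apply: DeriveDef.
  exact: (derivable_under_integral mD Ix If Df G0 intG G_ub).
rewrite -derive1E.
rewrite (differentiation_under_integral mD Ix If Df G0 intG G_ub).
under eq_Rintegral do rewrite d1f -mulN1r.
rewrite RintegralZl ?mulN1r//.
exact: laplace_moment_integrand_integrable.
Qed.

(** The induction uses the formula of order [n] on a neighbourhood of [x], which
is available because the half-line is open. *)
Lemma derive1n_laplace_moment (n : nat) (x : R) : 0 < x ->
  derive1n n (laplace_moment w 0) x = (-1) ^+ n * laplace_moment w n x.
Proof.
elim: n x => [|n IH] x x0; first by rewrite expr0 mul1r.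
rewrite derive1nS derive1E.
rewrite (near_eq_derive (g := (-1) ^+ n *: laplace_moment w n)); last first.
  near=> y; apply: IH; near: y.
  exact: lt_nbhsr.
have d := is_derive_laplace_moment n x0.
by rewrite deriveZ ?derive_val//; rewrite /GRing.scale/= exprS; ring.
Unshelve. all: by end_near. Qed.

Lemma laplace_moment_log_convex (n : nat) (x y a : R) :
  0 < x -> 0 < y -> 0 < a < 1 ->
  laplace_moment w n (a * x + (1 - a) * y) <=
  laplace_moment w n x `^ a * laplace_moment w n y `^ (1 - a).
Proof.
move=> x0 y0 a01.
have mD : measurable (D : set (measurableTypeR R)) by exact: measurable_itv.
pose f (z t : R) := t ^+ n * expR (- (z * t)) * w t.
have f0 z t : D t -> 0 <= f z t.
  move=> Dt; have t0 : 0 < t by move: Dt; rewrite /= in_itv/= andbT.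
  by rewrite !mulr_ge0 ?exprn_ge0 ?expR_ge0 ?w_ge0// ltW.
have := Rintegral_powR_le mD a01 (f0 x) (f0 y)
  (laplace_moment_integrand_integrable n x0)
  (laplace_moment_integrand_integrable n y0).
(* The integrand at [a * x + (1 - a) * y] equals the weighted geometric mean of
   the integrands at [x] and [y]. *)
apply: le_trans; rewrite le_eqVlt; apply/orP; left; apply/eqP.
apply: eq_Rintegral => t; rewrite inE => Dt.
have t0 : 0 <= t by move: Dt; rewrite /= in_itv/= andbT => /ltW.
have c0 : 0 <= t ^+ n * w t by rewrite mulr_ge0 ?exprn_ge0 ?w_ge0.
have fE z : f z t = t ^+ n * w t * expR (- (z * t)) by rewrite /f mulrAC.
rewrite -/(f _ t) !fE; move: (t ^+ n * w t) c0 {fE} => c c0.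
rewrite !powRM ?expR_ge0// -!expRM mulrACA -expRD -powRD; last first.
  by rewrite subrKC oner_eq0.
by rewrite subrKC powRr1//; congr (_ * expR _); ring.
Qed.

End laplace.

(** * Integrability of the weight of the Ramanujan integral *)

(** The density [1 / (t * (pi ^ 2 + ln t ^ 2))] on the positive half-line. *)
Definition ramanujan_weight {R : realType} (t : R) : R :=
  (t * (pi ^+ 2 + ln t ^+ 2))^-1.

Section weight.
Variable R : realType.
Local Notation mu := (@lebesgue_measure R).
Local Notation D := (`]0, +oo[%classic : set R).

Lemma ramanujan_weight_ge0 (t : R) : 0 < t -> 0 <= ramanujan_weight t.
Proof.
by move=> t0; rewrite invr_ge0 mulr_ge0 ?(ltW t0)// addr_ge0 ?sqr_ge0.
Qed.

Lemma continuous_ramanujan_weight (t : R) :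
  0 < t -> {for t, continuous ramanujan_weight}.
Proof.
move=> t0; apply: cvgV.
  by rewrite mulf_neq0 ?gt_eqF// ltr_pwDl ?sqr_ge0// exprn_gt0 ?pi_gt0.
apply: cvgM; first exact: cvg_id.
apply: cvgD; first exact: cvg_cst.
exact: (cvg_comp _ _ (continuous_ln t0) (@exprn_continuous R 2 (ln t))).
Qed.

(** The primitive [atan (ln t / pi) / pi] of the weight; it takes its values in
]-1/2, 1/2[. *)
Definition ramanujan_primitive (t : R) : R := pi^-1 * atan (pi^-1 * ln t).

Lemma is_derive_ramanujan_primitive (t : R) : 0 < t ->
  is_derive t 1 ramanujan_primitive (ramanujan_weight t).
Proof.
move=> t0; rewrite /ramanujan_primitive.
have dln := is_derive1_ln t0.
have dm : is_derive t (1 : R) (fun t : R => pi^-1 * ln t) (pi^-1 * t^-1).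
  exact: is_derive_eq.
 have dc : is_derive t (1 : R) (fun t : R => atan (pi^-1 * ln t))
    ((1 + (pi^-1 * ln t) ^+ 2)^-1 * (pi^-1 * t^-1)).
  exact: (@is_derive1_comp _ atan (fun t : R => pi^-1 * ln t) _ _ _
    (is_derive1_atan _) dm).
apply: is_derive_eq.
rewrite /GRing.scale/=.
rewrite /ramanujan_weight.
(* [pi] is made a variable, as [field] would unfold it. *)
move: (pi : R) (pi_gt0 R) => p p0.
by field; rewrite !gt_eqF// ltr_pwDl ?sqr_ge0 ?exprn_gt0.
Qed.

Lemma integral_ramanujan_weight_le1 (a b : R) : 0 < a -> a < b ->
  (\int[mu]_(t in `[a, b]) (ramanujan_weight t)%:E <= 1)%E.
Proof.
move=> a0 ab.
have pos t : a <= t -> 0 < t by exact: lt_le_trans.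
rewrite (@continuous_FTC2 _ _ ramanujan_primitive)//.
- rewrite -EFinB lee_fin /ramanujan_primitive -mulrBr mulrC.
  rewrite ler_pdivrMr ?pi_gt0// mul1r.
  have := atan_ltpi2 (pi^-1 * ln b); have := atan_gtNpi2 (pi^-1 * ln a).
  by lra.
- apply: continuous_in_subspaceT => t; rewrite inE/= in_itv/= => /andP[at_ _].
  exact/continuous_ramanujan_weight/pos.
- have cF t : a <= t -> {for t, continuous ramanujan_primitive}.
    move=> /pos t0; apply/differentiable_continuous/derivable1_diffP.
    by apply: ex_derive; exact: is_derive_ramanujan_primitive.
  split.
  + move=> t; rewrite in_itv/= => /andP[at_ _].
    by apply: ex_derive; apply: is_derive_ramanujan_primitive; exact/pos/ltW.
  + exact/cvg_at_right_filter/cF.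
  + exact/cvg_at_left_filter/cF/ltW.
- move=> t; rewrite in_itv/= => /andP[at_ _]; rewrite derive1E.
  have := is_derive_ramanujan_primitive (pos _ (ltW at_)).
  by move=> ?; rewrite derive_val.
Qed.

Lemma integrable_ramanujan_weight :
  mu.-integrable D (EFin \o (@ramanujan_weight R)).
Proof.
have mw : measurable_fun D (@ramanujan_weight R).
  apply: open_continuous_measurable_fun; first exact: interval_open.
  move=> t; rewrite inE/= in_itv/= andbT; exact: continuous_ramanujan_weight.
(* [n.+2] rather than [n.+1], so that no interval is reduced to a point. *)
pose F (n : nat) : set R := `[n.+2%:R^-1, n.+2%:R].
have F_D : \bigcup_n F n = D.
  apply/seteqP; split => [t [n _]|t]; rewrite /F/= !in_itv/= ?andbT.
    by move=> /andP[+ _]; apply: lt_le_trans; rewrite invr_gt0.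
  move=> t0; exists (Num.truncn (t + t^-1)) => //=; rewrite in_itv/=.
  have ti : 0 < t^-1 by rewrite invr_gt0.
  have := truncnS_gt (t + t^-1); set k := Num.truncn _ => tk.
  have kk : k.+1%:R <= k.+2%:R :> R by rewrite ler_nat.
  apply/andP; split; last by lra.
  by rewrite -[t]invrK lef_pV2 ?posrE//; lra.
have FsubD n : F n `<=` D by rewrite -F_D; exact: bigcup_sup.
have mF n : measurable (F n : set (measurableTypeR R)) by exact: measurable_itv.
have ndF : nondecreasing_seq F.
  move=> m n mn; apply/subsetPset => t; rewrite /F/= !in_itv/= => /andP[mt tm].
  rewrite (le_trans _ mt) ?(le_trans tm) ?ler_nat//.
  by rewrite lef_pV2 ?posrE// ler_nat.
have w0 n t : F n t -> (0 <= (ramanujan_weight t)%:E)%E.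
  move=> /FsubD; rewrite /= in_itv/= andbT lee_fin; exact: ramanujan_weight_ge0.
have mwF n : measurable_fun (F n) (EFin \o (@ramanujan_weight R)).
  by apply: (measurable_funS _ (@FsubD n)) => //; exact/measurable_EFinP.
apply/integrableP; split; first exact/measurable_EFinP.
have -> : (\int[mu]_(t in D) `|(EFin \o (@ramanujan_weight R)) t| =
    \int[mu]_(t in D) (ramanujan_weight t)%:E)%E.
  apply: eq_integral => t; rewrite inE/= in_itv/= andbT => t0.
  by rewrite ger0_norm ?ramanujan_weight_ge0.
apply: (@le_lt_trans _ _ 1%E); last exact: ltry.
have := @ge0_nondecreasing_set_cvg_integral _ (measurableTypeR R) R F _ mu
  ndF mF mwF w0.
rewrite F_D => wcvg.
apply: cvge_to_le wcvg _.
apply: nearW => n.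
apply: integral_ramanujan_weight_le1; first by rewrite invr_gt0.
by rewrite (@lt_trans _ _ 1) ?invf_lt1 ?ltr1n.
Qed.

End weight.

(** * Logarithmic convexity of the derivatives *)

Lemma ramanujan_integralE (R : realType) :
  @ramanujan_integral R = laplace_moment ramanujan_weight 0.
Proof.
by apply/funext => x; apply: eq_Rintegral => t _; rewrite expr0 mul1r.
Qed.

Unset Implicit Arguments.

Theorem theorem4 (R : realType) (n : nat) :
  (forall x y alpha : R, 0 < x -> 0 < y -> 0 < alpha < 1 ->
    (-1) ^+ n * derive1n n (@ramanujan_integral R)
                  (alpha * x + (1 - alpha) * y)
    <= ((-1) ^+ n * derive1n n (@ramanujan_integral R) x) `^ alpha
       * ((-1) ^+ n * derive1n n (@ramanujan_integral R) y) `^ (1 - alpha))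
  /\
  (forall x : R, 0 < x ->
    derive1n n (@ramanujan_integral R) (x + 1) ^+ 2
    <= derive1n n (@ramanujan_integral R) x
       * derive1n n (@ramanujan_integral R) (x + 2)).
Proof.
rewrite ramanujan_integralE.
have w0 (t : R) : `]0, +oo[%classic t -> 0 <= ramanujan_weight t.
  by rewrite /= in_itv/= andbT; exact: ramanujan_weight_ge0.
have iw := @integrable_ramanujan_weight R.
have dE (x : R) : 0 < x -> derive1n n (laplace_moment ramanujan_weight 0) x =
    (-1) ^+ n * laplace_moment ramanujan_weight n x.
  by move=> x0; rewrite derive1n_laplace_moment.
have sgK (z : R) : (-1) ^+ n * ((-1) ^+ n * z) = z by rewrite signrMK.
split=> [x y a x0 y0 a01|x x0].
  have z0 : 0 < a * x + (1 - a) * y.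
    by case/andP: (a01) => a0 a1; rewrite addr_gt0 ?mulr_gt0 ?subr_gt0.
  by rewrite !dE// !sgK; exact: laplace_moment_log_convex.
have [x1 x2] : 0 < x + 1 /\ 0 < x + 2 by split; lra.
rewrite !dE// mulrACA -expr2 sqrr_sign mul1r exprMn sqrr_sign mul1r.
have h01 : 0 < (2^-1 : R) < 1 by rewrite invr_gt0 invf_lt1 ?ltr1n ltr0n.
have := laplace_moment_log_convex w0 iw n x0 x2 h01.
have -> : 2^-1 * x + (1 - 2^-1) * (x + 2) = x + 1 :> R by field.
have -> : 1 - 2^-1 = 2^-1 :> R by field.
have F0 z := laplace_moment_ge0 w0 n z.
rewrite -powRM// => le_F.
apply: le_trans (lerXn2r 2 _ _ le_F) _; rewrite ?nnegrE ?powR_ge0//.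
by rewrite -powR_mulrn ?powR_ge0// -powRrM mulVf// powRr1// mulr_ge0.
Qed.
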